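(* Let $X$ be a Banach space and let $S,T\in B(X)$ be such that $ST=TS$ and $N((TS)^p)=N(T^p)\oplus N(S^p)$ for all $p\in\mathbb{N}$. Then $T$ and $S$ both have finite ascent if and only if $TS$ has finite ascent.
   Context: $B(X)$ is the algebra of bounded linear operators on $X$, and $N(T)$ denotes the null space of $T$. $\mathbb{N}=\{0,1,2,\dots\}$. The ascent of $T$ is the smallest $n\in\mathbb{N}$ with $N(T^n)=N(T^{n+1})$, and is $\infty$ if no such $n$ exists. The symbol $\oplus$ denotes the (internal algebraic) direct sum of subspaces, so that the equality includes the requirement that the two summands intersect only in $\{0\}$. *)

(* Defs.v *)
From mathcomp Require Import all_boot all_order all_algebra.
From mathcomp Require Import all_classical all_reals all_analysis.

Set Implicit Arguments.
Unset Strict Implicit.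
Unset Printing Implicit Defensive.

Import numFieldNormedType.Exports.

Local Open Scope classical_set_scope.
Local Open Scope ring_scope.

Definition null_space (V : zmodType) (f : V -> V) : set V :=
  [set x | f x = 0].

(* C = A (+) B for additive subgroups A and B (the library notation A `+` B
   is the symmetric difference, hence the explicit image). *)
Definition is_direct_sum (V : zmodType) (C A B : set V) : Prop :=
  C = [set a + b | a in A & b in B] /\ A `&` B = [set 0].

(* None stands for infinite ascent. *)
Definition ascent (V : zmodType) (f : V -> V) : option nat :=
  if pselect (exists n : nat,
       `[< null_space (iter n f) = null_space (iter n.+1 f) >]) is left h
  then Some (ex_minn h) else None.

Definition finite_ascent (V : zmodType) (f : V -> V) : Prop :=
  exists n : nat, ascent f = Some n.

(* Main.v *)
(* If a sum of two increasing families of subgroups A_p (+) B_p is direct and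
   A_p (+) B_p = A_q (+) B_q with p <= q, then A_p = A_q: write x in A_q as
   a + b in A_p (+) B_p, so that b = x - a lies in A_q and B_q, hence b = 0.
   Applied to the null spaces of the powers of T and S, this shows that the null
   spaces of the powers of TS stabilize exactly when those of T and S both do. *)
Require Import Defs.
From mathcomp Require Import all_boot all_order all_algebra.
From mathcomp Require Import all_classical all_reals all_analysis.

Set Implicit Arguments.
Unset Strict Implicit.
Unset Printing Implicit Defensive.

Import GRing.Theory numFieldNormedType.Exports.

Local Open Scope classical_set_scope.
Local Open Scope ring_scope.

(** Any exponent at which two consecutive null spaces agree will do, so no minimality has to be
    tracked afterwards. *)
Lemma finite_ascentP (V : zmodType) (f : V -> V) :
  finite_ascent f <->
  exists n, null_space (iter n f) = null_space (iter n.+1 f).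
Proof.
rewrite /finite_ascent /ascent; case: pselect => [h|nh]; split.
- by case: h => n /asboolP e _; exists n.
- by move=> _; exists (ex_minn h).
- by case.
- by case=> n e; case: nh; exists n; apply/asboolP.
Qed.

Lemma is_direct_sumC (V : zmodType) (C A B : set V) :
  is_direct_sum C A B -> is_direct_sum C B A.
Proof.
case=> CE AB; split; last by rewrite setIC.
rewrite CE; apply/seteqP; split=> _ [a Aa [b Bb <-]];
  by exists b => //; exists a => //; rewrite addrC.
Qed.

Lemma is_direct_sum_inj (V : zmodType) (C A B A' B' : set V) :
  is_direct_sum C A B -> is_direct_sum C A' B' ->
  A `<=` A' -> B `<=` B' ->
  (forall x y, A' x -> A' y -> A' (x - y)) -> A = A'.
Proof.
move=> [CE _] [CE' A'B'] AA' BB' subA'; apply/seteqP; split=> // x A'x.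
(* [B'] is a bare set, so its containing 0 is read off from the trivial intersection; this puts
   [x = x + 0] in [C]. *)
have [_ B'0] : (A' `&` B') 0 by rewrite A'B'.
have : C x by rewrite CE'; exists x => //; exists 0 => //; rewrite addr0.
rewrite CE => -[a Aa [b Bb abx]].
suff b0 : b = 0 by rewrite -abx b0 addr0.
have : (A' `&` B') b.
  split; last exact: BB'.
  have -> : b = x - a by rewrite -abx addrC addKr.
  by apply: subA' => //; exact: AA'.
by rewrite A'B'.
Qed.

Lemma null_space_iterB (V : zmodType) (f : {additive V -> V}) n x y :
  null_space (iter n f) x -> null_space (iter n f) y ->
  null_space (iter n f) (x - y).
Proof.
have iterB : iter n f (x - y) = iter n f x - iter n f y.
  by elim: n => //= n ->; rewrite raddfB.
by rewrite /null_space /= iterB => -> ->; rewrite subr0.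
Qed.

Lemma null_space_iterS (V : zmodType) (f : {additive V -> V}) n :
  null_space (iter n f) `<=` null_space (iter n.+1 f).
Proof. by move=> x; rewrite /null_space /= => ->; rewrite raddf0. Qed.

(** The null space of [f^(k+j)] is the preimage under [f^k] of that of [f^j], so pulling the
    equality at [n] back along [f^k] gives the one at [k + n]. *)
Lemma null_space_iter_stable (V : zmodType) (f : V -> V) n m :
  null_space (iter n f) = null_space (iter n.+1 f) -> (n <= m)%N ->
  null_space (iter m f) = null_space (iter n f).
Proof.
move=> e /subnK <-; elim: (m - n)%N => // k <-.
have shift j x : null_space (iter (k + j) f) x =
    null_space (iter j f) (iter k f x).
  by rewrite /null_space /= addnC iterD.
by apply/funext => x; rewrite addSnnS !shift e.
Qed.

Theorem lemma2p1 (K : numFieldType) (X : completeNormedModType K)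
  (S T : {linear X -> X})
  (bS : bounded_near S (nbhs (0 : X))) (bT : bounded_near T (nbhs (0 : X)))
  (ST : S \o T = T \o S)
  (dirN : forall p : nat,
    is_direct_sum (null_space (iter p (T \o S)))
                  (null_space (iter p T)) (null_space (iter p S))) :
  (finite_ascent T /\ finite_ascent S) <-> finite_ascent (T \o S).
Proof.
split=> [[/finite_ascentP[m Tm] /finite_ascentP[n Sn]]|].
  (* From this exponent on both chains are constant, so the sums at it and at its successor have the
     same summands. *)
  apply/finite_ascentP; exists (maxn m n).
  have [-> _] := dirN (maxn m n); have [-> _] := dirN (maxn m n).+1.
  have lem := leq_maxl m n; have len := leq_maxr m n.
  rewrite (null_space_iter_stable Tm lem) (null_space_iter_stable Sn len).
  by rewrite (null_space_iter_stable Tm (leqW lem))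
             (null_space_iter_stable Sn (leqW len)).
case/finite_ascentP=> p TSp.
(* The null space of [(TS)^(p+1)] now has two decompositions, with summands taken at [p] and at
   [p + 1]. *)
have dirp := dirN p; rewrite TSp in dirp; have dirp1 := dirN p.+1.
split; apply/finite_ascentP; exists p.
  apply: (is_direct_sum_inj dirp dirp1); try exact: null_space_iterS.
  exact: null_space_iterB.
(* Swapping the summands lets the same comparison treat [S]. *)
apply: (is_direct_sum_inj (is_direct_sumC dirp) (is_direct_sumC dirp1));
  try exact: null_space_iterS.
exact: null_space_iterB.
Qed.
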